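(* Let $S\in\{\tfrac12,1,\tfrac32,\dots\}$ and $\alpha\in\mathbb R$. On the $(2S+1)$-dimensional space $\mathcal H_{\mathrm{phys}}$ with basis $|0\rangle,|1\rangle,\dots,|2S\rangle$ define $$\hat S^+_\alpha|n\rangle=\sqrt{2S}\,\sqrt n\left(1-\frac{n-1}{2S}\right)^{\alpha}|n-1\rangle\quad(1\le n\le 2S),\qquad \hat S^+_\alpha|0\rangle=0,$$ $$\hat S^-_\alpha|n\rangle=\sqrt{2S}\,\sqrt{n+1}\left(1-\frac{n}{2S}\right)^{1-\alpha}|n+1\rangle\quad(0\le n\le 2S-1),\qquad \hat S^-_\alpha|2S\rangle=0,$$ $$\hat S^z|n\rangle=(S-n)|n\rangle .$$ Then for every $\alpha\in\mathbb R$ $$[\hat S^z,\hat S^\pm_\alpha]=\pm\hat S^\pm_\alpha,\qquad [\hat S^+_\alpha,\hat S^-_\alpha]=2\hat S^z .$$ Moreover, writing $G(n)=2S-n+1$, the functions $$f_{1\alpha}(n)=\sqrt{2S}\left(\frac{G(n)}{2S}\right)^{\alpha},\qquad f_{2\alpha}(n)=\sqrt{2S}\left(\frac{G(n)}{2S}\right)^{1-\alpha}$$ satisfy $f_{1\alpha}(n)f_{2\alpha}(n)=G(n)$ for $1\le n\le 2S$, and $\hat S_\alpha^+$, $\hat S_\alpha^-$ have the same matrix elements between $|m\rangle,|n\rangle$ $(0\le m,n\le 2S)$ as $\hat a f_{1\alpha}(\hat n)$ and $f_{2\alpha}(\hat n)\hat a^\dagger$, respectively. For $\alpha=\tfrac12$,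 $\alpha=1$ and $\alpha=0$ these matrix elements are those of the Holstein--Primakoff, Dyson--Maleev and dual Dyson--Maleev operators, respectively.
   Context: On the single-mode Fock space with basis $\{|n\rangle:n\in\mathbb N_0\}$, $\hat a|n\rangle=\sqrt n|n-1\rangle$, $\hat a^\dagger|n\rangle=\sqrt{n+1}|n+1\rangle$, $\hat n=\hat a^\dagger\hat a$, and $F(\hat n)|n\rangle=F(n)|n\rangle$ for a function $F$. $\mathcal H_{\mathrm{phys}}=\mathrm{span}\{|n\rangle:0\le n\le2S\}$. In all cases $\hat S^z=S-\hat n$. The three named transformations are: Holstein--Primakoff: $\hat S^+=\sqrt{2S}\,(1-\tfrac{\hat n}{2S})^{1/2}\hat a$, $\hat S^-=\hat a^\dagger\sqrt{2S}\,(1-\tfrac{\hat n}{2S})^{1/2}$. Dyson--Maleev: $\hat S^+=\sqrt{2S}\,(1-\tfrac{\hat n}{2S})\hat a$, $\hat S^-=\sqrt{2S}\,\hat a^\dagger$. Dual Dyson--Maleev: $\hat S^+=\sqrt{2S}\,\hat a$, $\hat S^-=\hat a^\dagger\sqrt{2S}\,(1-\tfrac{\hat n}{2S})$. Only matrix elements between the physical basis vectors $|0\rangle,\dots,|2S\rangle$ are considered; powers with positive base and real exponent are the usual real powers. *)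

(* Defs.v *)
From HB Require Import structures.
From mathcomp Require Import all_boot all_order all_algebra.
From mathcomp Require Import reals exp.
From mathcomp Require Import complex.
Set Implicit Arguments.
Unset Strict Implicit.
Unset Printing Implicit Defensive.
Import Order.TTheory GRing.Theory Num.Theory.
Local Open Scope ring_scope.
Local Open Scope complex_scope.

(* The spin S in {1/2, 1, 3/2, ...} is carried by the natural number
   twoS = 2S >= 1.  The Hilbert spaces are complex; the real coefficients of
   the operators are injected into R[i] by %:C. *)
Definition spin (R : realType) (twoS : nat) : R := twoS%:R / 2.

(* Fock space: the span of the number states |n>, which is stable under all the
   (unbounded) operators below.  {poly R[i]} is used only as the space of
   finitely supported sequences: |n> is 'X^n and the coefficient psi`_n is
   <n|psi>; the multiplication of polynomials plays no role. *)
Definition fock (R : realType) := {poly R[i]}.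

Section Fock.
Variable R : realType.
Implicit Types (f : nat -> fock R) (F : nat -> R) (psi : fock R).

Definition fket (n : nat) : fock R := 'X^n.

(* The linear operator sending |n> to f n. *)
Definition fock_op f psi : fock R := \sum_(n < size psi) psi`_n *: f n.

Lemma fock_op_widen f psi m : (size psi <= m)%N ->
  fock_op f psi = \sum_(n < m) psi`_n *: f n.
Proof.
move=> le_m; rewrite /fock_op (big_ord_widen m (fun n => psi`_n *: f n) le_m).
rewrite big_mkcond; apply: eq_bigr => n _.
by case: ltnP => // le_n; rewrite nth_default // scale0r.
Qed.

Lemma fock_op_is_linear f : linear (fock_op f).
Proof.
move=> c p q; pose m := maxn (size (c *: p + q)) (maxn (size p) (size q)).
rewrite !(@fock_op_widen f _ m) ?leq_max ?leqnn ?orbT // scaler_sumr -big_split.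
by apply: eq_bigr => n _; rewrite /= coefD coefZ scalerDl scalerA.
Qed.

Lemma fock_op_ket f n : fock_op f (fket n) = f n.
Proof.
rewrite /fock_op size_polyXn big_ord_recr /= coefXn eqxx scale1r big1 ?add0r //.
by move=> i _; rewrite coefXn ltn_eqF // scale0r.
Qed.

Definition ann : fock R -> fock R :=
  fock_op (fun n => (Num.sqrt n%:R)%:C *: fket n.-1).

Definition cre : fock R -> fock R :=
  fock_op (fun n => (Num.sqrt n.+1%:R)%:C *: fket n.+1).

Definition num psi : fock R := cre (ann psi).

Definition num_fun F : fock R -> fock R := fock_op (fun n => (F n)%:C *: fket n).

(* <m|T|n>; the number states are orthonormal. *)
Definition fock_elt (T : fock R -> fock R) (m n : nat) : R[i] := (T (fket n))`_m.

End Fock.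

Section Transformations.
Variables (R : realType) (twoS : nat).
Implicit Types psi : fock R.

Let sqrt2S : R[i] := (Num.sqrt (twoS%:R : R))%:C.

Definition hole (n : nat) : R := 1 - n%:R / twoS%:R.

(* On |n> with n > 2S the base of the square root is negative and powR takes
   a junk value; these states do not contribute to the matrix elements between
   |0>, ..., |2S>. *)
Definition sqrt_hole (n : nat) : R := powR (hole n) (1 / 2).

Definition fock_Sz psi : fock R := (spin R twoS)%:C *: psi - num psi.

Definition HP_Sp psi : fock R := sqrt2S *: num_fun sqrt_hole (ann psi).
Definition HP_Sm psi : fock R := cre (sqrt2S *: num_fun sqrt_hole psi).

Definition DM_Sp psi : fock R := sqrt2S *: num_fun hole (ann psi).
Definition DM_Sm psi : fock R := sqrt2S *: cre psi.

Definition dualDM_Sp psi : fock R := sqrt2S *: ann psi.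
Definition dualDM_Sm psi : fock R := cre (sqrt2S *: num_fun hole psi).

(* Real subtraction, not the truncated one.  The junk values of
   f1 and f2 beyond n = 2S do not contribute to the matrix elements between
   |0>, ..., |2S> either. *)
Definition G (n : nat) : R := twoS%:R - n%:R + 1.

Definition f1 (alpha : R) (n : nat) : R :=
  Num.sqrt twoS%:R * powR (G n / twoS%:R) alpha.

Definition f2 (alpha : R) (n : nat) : R :=
  Num.sqrt twoS%:R * powR (G n / twoS%:R) (1 - alpha).

End Transformations.

Section Physical.
Variables (R : realType) (twoS : nat).

(* The physical space is 'cV[R[i]]_(twoS.+1), with |n> the n-th vector of the
   canonical basis, and its operators are matrices acting on the left on
   column vectors, so that A m n = <m|A|n>. *)
Definition ket (n : nat) : 'cV[R[i]]_(twoS.+1) := delta_mx (inord n) 0.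

(* The operator sending |n> to v n for 0 <= n <= 2S. *)
Definition phys_op (v : nat -> 'cV[R[i]]_(twoS.+1)) : 'M[R[i]]_(twoS.+1) :=
  \matrix_(m, n) v n m 0.

Lemma phys_op_ket v (n : nat) : (n <= twoS)%N -> phys_op v *m ket n = v n.
Proof.
move=> le_n; rewrite -colE; apply/matrixP => m j.
by rewrite !mxE inordK // (ord1 j).
Qed.

Definition Sp (alpha : R) : 'M[R[i]]_(twoS.+1) :=
  phys_op (fun n => if n == 0%N then 0 else
    (Num.sqrt twoS%:R * Num.sqrt n%:R
       * powR (1 - (n%:R - 1) / twoS%:R) alpha)%:C *: ket n.-1).

Definition Sm (alpha : R) : 'M[R[i]]_(twoS.+1) :=
  phys_op (fun n => if n == twoS then 0 else
    (Num.sqrt twoS%:R * Num.sqrt n.+1%:R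
       * powR (1 - n%:R / twoS%:R) (1 - alpha))%:C *: ket n.+1).

Definition Sz : 'M[R[i]]_(twoS.+1) :=
  phys_op (fun n => (spin R twoS - n%:R)%:C *: ket n).

End Physical.

Definition commutator (K : pzRingType) (n : nat) (A B : 'M[K]_n) : 'M[K]_n :=
  A *m B - B *m A.

(* T, restricted to matrix elements between |0>, ..., |2S>, is A. *)
Definition same_elts (R : realType) (twoS : nat)
    (A : 'M[R[i]]_(twoS.+1)) (T : fock R -> fock R) : Prop :=
  forall m n : 'I_(twoS.+1), A m n = fock_elt T m n.

(* Main.v *)
(* Every operator is a weighted shift of the basis, so each identity reduces to
   one on weights.  In [S+, S-] the exponents alpha and 1 - alpha meet at the
   same base, so alpha drops out and
   (n + 1) (2S - n) - n (2S - n + 1) = 2 (S - n); the truncation of S- at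
   n = 2S is harmless because 2S - n vanishes there. *)
Require Import Defs.
From HB Require Import structures.
From mathcomp Require Import all_boot all_order all_algebra.
From mathcomp Require Import reals exp.
From mathcomp Require Import complex.
From mathcomp Require Import ring.
Import Order.TTheory GRing.Theory Num.Theory.
Local Open Scope ring_scope.
Local Open Scope complex_scope.

(** * Matrix elements and commutators on the physical space *)

Section PhysicalMatrixElements.
Variables (R : realType) (twoS : nat).
Implicit Types (alpha : R) (m n : 'I_twoS.+1) (A : 'M[R[i]]_twoS.+1).

Definition Sp_coef alpha (n : nat) : R :=
  Num.sqrt twoS%:R * Num.sqrt n%:R * powR (1 - (n%:R - 1) / twoS%:R) alpha.

Definition Sm_coef alpha (n : nat) : R :=
  Num.sqrt twoS%:R * Num.sqrt n.+1%:R * powR (1 - n%:R / twoS%:R) (1 - alpha).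

(** Testing [m.+1 == n] instead of [m == n.-1] is already false at n = 0, which absorbs the separate
    case of the vacuum. *)
Lemma SpE alpha m n : Sp twoS alpha m n = (Sp_coef alpha n *+ (m.+1 == n))%:C.
Proof.
rewrite mxE; case: eqVneq => [->|n_neq0]; first by rewrite mxE raddf0.
rewrite !mxE eqxx andbT -val_eqE /= inordK ?(leq_ltn_trans (leq_pred n)) //.
have -> : (m == n.-1 :> nat) = (m.+1 == n).
  by rewrite -[in RHS](prednK (n := n)) ?lt0n.
by rewrite mulr_natr -raddfMn.
Qed.

(** At n = 2S no index m equals n + 1, so the truncation of S- needs no case of its own. *)
Lemma SmE alpha m n :
  Sm twoS alpha m n = (Sm_coef alpha n *+ (m == n.+1 :> nat))%:C.
Proof.
rewrite mxE; case: eqVneq => [nE|n_neq].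
  by rewrite mxE nE ltn_eqF ?raddf0.
rewrite !mxE eqxx andbT -val_eqE /= inordK ?mulr_natr -?raddfMn //.
by rewrite ltnS ltn_neqAle n_neq -ltnS /=.
Qed.

Lemma SzE m n : Sz R twoS m n = ((spin R twoS - n%:R) *+ (m == n))%:C.
Proof. by rewrite !mxE eqxx andbT inord_val mulr_natr -raddfMn. Qed.

(** Sz is diagonal, so only (S - m) - (S - n) survives. This factor is 1 on the entries of S+, where
    n = m + 1, and -1 on those of S-, where m = n + 1. *)
Lemma commutator_SzE A m n :
  commutator (Sz R twoS) A m n = (n%:R - m%:R)%:C * A m n.
Proof.
rewrite !mxE (bigD1 m) //= big1 => [|k k_neq]; last first.
  by rewrite SzE eq_sym (negPf k_neq) mulr0n mul0r.
rewrite [X in _ - X](bigD1 n) //= big1 => [|k k_neq]; last first.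
  by rewrite SzE (negPf k_neq) mulr0n mulr0.
rewrite !SzE !eqxx !mulr1n !addr0 [X in _ - X]mulrC -mulrBl -raddfB /=.
by congr (_%:C * _); ring.
Qed.

Lemma commutator_Sz_Sp alpha :
  commutator (Sz R twoS) (Sp twoS alpha) = Sp twoS alpha.
Proof.
apply/matrixP => m n; rewrite commutator_SzE SpE -rmorphM /=.
case: eqP => [<-|_]; last by rewrite mulr0.
by congr (_%:C); ring.
Qed.

Lemma commutator_Sz_Sm alpha :
  commutator (Sz R twoS) (Sm twoS alpha) = - Sm twoS alpha.
Proof.
apply/matrixP => m n; rewrite commutator_SzE [RHS]mxE SmE -rmorphM -raddfN /=.
case: eqP => [->|_]; last by rewrite mulr0 oppr0.
by congr (_%:C); ring.
Qed.

Lemma hole_gt0 (n : nat) : (n < twoS)%N -> 0 < 1 - n%:R / twoS%:R :> R.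
Proof.
move=> lt_n; rewrite subr_gt0 ltr_pdivrMr ?mul1r ?ltr_nat //.
by rewrite ltr0n (leq_ltn_trans _ lt_n).
Qed.

Lemma powR_mul_dual (x alpha : R) : 0 < x -> powR x alpha * powR x (1 - alpha) = x.
Proof.
move=> x_gt0; rewrite -powRD; last by rewrite (gt_eqF x_gt0) implybT.
by rewrite addrC subrK powRr1 // ltW.
Qed.

(** With S+ taken at n + 1, both powers have the base 1 - n/2S, which is positive for n < 2S; the
    square roots pair up to 2S (n + 1). *)
Lemma Sp_coef_mul_Sm_coef alpha (n : nat) : (n < twoS)%N ->
  Sp_coef alpha n.+1 * Sm_coef alpha n = n.+1%:R * (twoS%:R - n%:R).
Proof.
move=> lt_n; rewrite /Sp_coef /Sm_coef -natr1 addrK natr1 mulrACA.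
rewrite powR_mul_dual ?hole_gt0 // [X in X * _]mulrACA -!expr2 !sqr_sqrtr ?ler0n //.
have twoS_neq0 : twoS%:R != 0 :> R.
  by rewrite pnatr_eq0 -lt0n (leq_ltn_trans _ lt_n).
by rewrite -natr1; field.
Qed.

(** Row m of S+ meets only the intermediate state |m+1>, which exists for m < 2S. *)
Lemma Sp_Sm_mulE alpha m n : (Sp twoS alpha *m Sm twoS alpha) m n =
  (n.+1%:R * (twoS%:R - n%:R) *+ (m == n))%:C.
Proof.
rewrite mxE; have [lt_m|le_m] := ltnP m twoS.
  rewrite (bigD1 (Ordinal (lt_m : m.+1 < twoS.+1)%N)) //= big1 => [|k k_neq].
    rewrite addr0 SpE SmE eqxx -rmorphM /= mulr1n eqSS val_eqE.
    case: eqP => [<-|_]; last by rewrite mulr0.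
    by rewrite !mulr1n Sp_coef_mul_Sm_coef.
  rewrite SpE [_ == _ :> nat]eq_sym.
  by have /negPf-> : k != m.+1 :> nat := k_neq; rewrite mul0r.
(* The row m = 2S of S+ is zero, in agreement with the factor 2S - n on the diagonal. *)
have mE : m = twoS :> nat by apply/eqP; rewrite eqn_leq le_m -ltnS ltn_ord.
rewrite big1 => [|k _]; last by rewrite SpE mE gtn_eqF ?mul0r.
by case: eqP => // <-; rewrite mE subrr mulr0 mul0rn.
Qed.

(** Here the column n of S+ selects the intermediate state |n-1>; for n = 0 the column is zero, and
    so is the factor n. *)
Lemma Sm_Sp_mulE alpha m n : (Sm twoS alpha *m Sp twoS alpha) m n =
  (n%:R * (twoS%:R - n%:R + 1) *+ (m == n))%:C.
Proof.
rewrite mxE; case nE: (n : nat) => [|n'].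
  rewrite mul0r mul0rn big1 // => k _.
  by rewrite [X in _ * X]SpE nE mulr0.
have lt_n' : (n' < twoS)%N by rewrite -ltnS -nE.
rewrite (bigD1 (Ordinal (leqW lt_n'))) //= big1 => [|k k_neq].
  rewrite addr0 SpE SmE nE eqxx -rmorphM /= mulr1n -nE val_eqE.
  case: eqP => [_|_]; last by rewrite mul0r.
  rewrite !mulr1n nE mulrC Sp_coef_mul_Sm_coef //.
  by congr (_%:C); rewrite -natr1; ring.
rewrite [X in _ * X]SpE nE eqSS.
by have /negPf-> : k != n' :> nat := k_neq; rewrite mulr0.
Qed.

Lemma commutator_Sp_Sm alpha :
  commutator (Sp twoS alpha) (Sm twoS alpha) = 2%:R *: Sz R twoS.
Proof.
apply/matrixP => m n.
rewrite [LHS]mxE [X in _ + X]mxE Sp_Sm_mulE Sm_Sp_mulE [RHS]mxE SzE -raddfB /=.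
(* The complex scalar 2 is moved under [%:C], which leaves an identity of real weights. *)
rewrite -(rmorph_nat (real_complex R) 2) -rmorphM /=; congr (_%:C).
case: eqP => _; rewrite ?mulr0n ?subr0 ?mulr0 // !mulr1n /spin -natr1.
by field.
Qed.

End PhysicalMatrixElements.

(** * Action of the Fock space operators on number states *)

Section FockMatrixElements.
Variable R : realType.
Implicit Types (F : nat -> R) (psi : fock R).

(** [num_fun], [ann] and [cre] unfold to [fock_op], so this one instance lets scalars pass through
    all three. *)
HB.instance Definition _ (f : nat -> fock R) :=
  GRing.isLinear.Build _ _ _ _ (fock_op f) (fock_op_is_linear f).

Lemma num_funZ F (c : R[i]) psi : num_fun F (c *: psi) = c *: num_fun F psi.
Proof. exact: linearZ. Qed.

Lemma annZ (c : R[i]) psi : ann (c *: psi) = c *: ann psi.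
Proof. exact: linearZ. Qed.

Lemma creZ (c : R[i]) psi : cre (c *: psi) = c *: cre psi.
Proof. exact: linearZ. Qed.

Lemma num_fun_ket F n : num_fun F (fket R n) = (F n)%:C *: fket R n.
Proof. exact: fock_op_ket. Qed.

Lemma ann_ket n : ann (fket R n) = (Num.sqrt n%:R)%:C *: fket R n.-1.
Proof. exact: fock_op_ket. Qed.

Lemma cre_ket n : cre (fket R n) = (Num.sqrt n.+1%:R)%:C *: fket R n.+1.
Proof. exact: fock_op_ket. Qed.

Lemma num_ket n : num (fket R n) = n%:R%:C *: fket R n.
Proof.
rewrite /num ann_ket creZ cre_ket scalerA -rmorphM /=.
(* At n = 0 raising [n.-1] yields |1> rather than |0>, but its weight is zero. *)
case: n => [|n] /=; first by rewrite sqrtr0 mul0r raddf0 !scale0r.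
by rewrite -expr2 sqr_sqrtr // ler0n.
Qed.

Lemma fketE (c : R) n m : (c%:C *: fket R n)`_m = (c *+ (m == n))%:C.
Proof. by rewrite coefZ coefXn mulr_natr -raddfMn. Qed.

End FockMatrixElements.

(** * Comparison of ladder operators through their weights *)

Section SameElements.
Variables (R : realType) (twoS : nat).

(* The assumption at n = 0 only kills the spurious |0.-1> = |0>. *)
Lemma same_elts_Sp (alpha : R) (T : fock R -> fock R) (c : nat -> R) :
  (forall n, T (fket R n) = (c n)%:C *: fket R n.-1) -> c 0 = 0 ->
  (forall n, (0 < n <= twoS)%N -> c n = Sp_coef R twoS alpha n) ->
  same_elts (Sp twoS alpha) T.
Proof.
move=> TE c0 cE m n; rewrite SpE /fock_elt TE fketE.
case nE: (n : nat) => [|n'] /=; first by rewrite c0 mul0rn.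
by rewrite eqSS cE //= -ltnS -nE.
Qed.

(** Weights are compared for n < 2S only, since T sends |2S> to a multiple of |2S+1>, outside the
    physical space. *)
Lemma same_elts_Sm (alpha : R) (T : fock R -> fock R) (c : nat -> R) :
  (forall n, T (fket R n) = (c n)%:C *: fket R n.+1) ->
  (forall n, (n < twoS)%N -> c n = Sm_coef R twoS alpha n) ->
  same_elts (Sm twoS alpha) T.
Proof.
move=> TE cE m n; rewrite SmE /fock_elt TE fketE.
by case: eqP => // mE; rewrite cE // -ltnS -mE.
Qed.

End SameElements.
Theorem mainTheorem2 (R : realType) (twoS : nat) (twoS_gt0 : (0 < twoS)%N) :
  (forall alpha : R,
    [/\ commutator (Sz R twoS) (Sp twoS alpha) = Sp twoS alpha,
        commutator (Sz R twoS) (Sm twoS alpha) = - Sm twoS alpha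
      & commutator (Sp twoS alpha) (Sm twoS alpha) = 2%:R *: Sz R twoS])
  /\
  (forall alpha : R,
    [/\ forall n : nat, (1 <= n <= twoS)%N ->
          f1 twoS alpha n * f2 twoS alpha n = G R twoS n,
        same_elts (Sp twoS alpha)
          (fun psi => ann (num_fun (f1 twoS alpha) psi))
      & same_elts (Sm twoS alpha)
          (fun psi => num_fun (f2 twoS alpha) (cre psi))])
  /\
  [/\ same_elts (Sz R twoS) (@fock_Sz R twoS),
      same_elts (Sp twoS (1 / 2 : R)) (@HP_Sp R twoS)
        /\ same_elts (Sm twoS (1 / 2 : R)) (@HP_Sm R twoS),
      same_elts (Sp twoS (1 : R)) (@DM_Sp R twoS)
        /\ same_elts (Sm twoS (1 : R)) (@DM_Sm R twoS)
    & same_elts (Sp twoS (0 : R)) (@dualDM_Sp R twoS)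
        /\ same_elts (Sm twoS (0 : R)) (@dualDM_Sm R twoS)].
Proof.
have twoS_neq0 : twoS%:R != 0 :> R by rewrite pnatr_eq0 -lt0n.
(* The base of the powers in [f1] and [f2] is that of S+ at n and that of S- at n - 1; [hole] gives
   the former once the annihilator has lowered n. *)
have GE n : G R twoS n / twoS%:R = 1 - (n%:R - 1) / twoS%:R.
  by rewrite /G; field.
have GSE n : G R twoS n.+1 / twoS%:R = 1 - n%:R / twoS%:R.
  by rewrite GE -natr1 addrK.
have holeE n : (0 < n)%N -> hole R twoS n.-1 = 1 - (n%:R - 1) / twoS%:R.
  by case: n => // n _; rewrite /hole /= -natr1 addrK.
split; [|split] => [alpha|alpha|].
- by split; [exact: commutator_Sz_Sp|exact: commutator_Sz_Sm
    |exact: commutator_Sp_Sm].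
- split.
  + case=> // n lt_n; rewrite /f1 /f2 mulrACA powR_mul_dual ?GSE ?hole_gt0 //.
    by rewrite -expr2 sqr_sqrtr ?ler0n // -GSE mulrC divfK.
  + apply: (@same_elts_Sp _ _ _ _ (fun n => f1 twoS alpha n * Num.sqrt n%:R)).
    * by move=> n; rewrite num_fun_ket annZ ann_ket scalerA -rmorphM.
    * by rewrite sqrtr0 mulr0.
    * by move=> n _; rewrite /f1 /Sp_coef GE mulrAC.
  (* [f2] acts after the creation operator, hence on n + 1, whereas [f1] acts before the
     annihilator, on n. *)
  + apply: (@same_elts_Sm _ _ _ _
      (fun n => Num.sqrt n.+1%:R * f2 twoS alpha n.+1)).
    * by move=> n; rewrite cre_ket num_funZ num_fun_ket scalerA -rmorphM.
    * by move=> n _; rewrite /f2 /Sm_coef GSE mulrCA mulrA.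
- split.
  + move=> m n; rewrite SzE /fock_elt /fock_Sz num_ket -scalerBl -raddfB /=.
    by rewrite fketE.
  + split.
      apply: (@same_elts_Sp _ _ _ _ (fun n =>
        Num.sqrt twoS%:R * (Num.sqrt n%:R * sqrt_hole R twoS n.-1))).
      * move=> n; rewrite /HP_Sp ann_ket num_funZ num_fun_ket !scalerA.
        by rewrite -!rmorphM /= mulrA.
      * by rewrite sqrtr0 mul0r mulr0.
      * by move=> n /andP[n_gt0 _]; rewrite /sqrt_hole holeE // mulrA.
    apply: (@same_elts_Sm _ _ _ _ (fun n =>
      Num.sqrt twoS%:R * sqrt_hole R twoS n * Num.sqrt n.+1%:R)).
    * move=> n; rewrite /HP_Sm num_fun_ket !creZ cre_ket !scalerA.
      by rewrite -!rmorphM.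
    * move=> n _; rewrite /sqrt_hole /hole /Sm_coef mulrAC.
      (* At alpha = 1/2 the exponents alpha and 1 - alpha coincide. *)
      by congr (_ * powR _ _); field.
  + split.
      apply: (@same_elts_Sp _ _ _ _ (fun n =>
        Num.sqrt twoS%:R * (Num.sqrt n%:R * hole R twoS n.-1))).
      * move=> n; rewrite /DM_Sp ann_ket num_funZ num_fun_ket !scalerA.
        by rewrite -!rmorphM /= mulrA.
      * by rewrite sqrtr0 mul0r mulr0.
      (* The power with exponent 1 is the base itself because the base is nonnegative for these
         n. *)
      * case=> // n lt_n; rewrite /Sp_coef -holeE // powRr1 ?mulrA //.
        by rewrite ltW // hole_gt0.
    apply: (@same_elts_Sm _ _ _ _ (fun n =>
      Num.sqrt twoS%:R * Num.sqrt n.+1%:R)).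
    * by move=> n; rewrite /DM_Sm cre_ket scalerA -rmorphM.
    * by move=> n _; rewrite /Sm_coef subrr powRr0 mulr1.
  + split.
      apply: (@same_elts_Sp _ _ _ _ (fun n => Num.sqrt twoS%:R * Num.sqrt n%:R)).
      * by move=> n; rewrite /dualDM_Sp ann_ket scalerA -rmorphM.
      * by rewrite sqrtr0 mulr0.
      * by move=> n _; rewrite /Sp_coef powRr0 mulr1.
    apply: (@same_elts_Sm _ _ _ _ (fun n =>
      Num.sqrt twoS%:R * hole R twoS n * Num.sqrt n.+1%:R)).
    * move=> n; rewrite /dualDM_Sm num_fun_ket !creZ cre_ket !scalerA.
      by rewrite -!rmorphM.
    * move=> n lt_n; rewrite /Sm_coef subr0 powRr1 ?ltW ?hole_gt0 //.
      by rewrite mulrAC.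
Qed.
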